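(* For an arbitrary valid substitution $\vdash\sigma:\Xi\Rightarrow\Xi'$ the following holds: if $\Xi;\Gamma\vdash v:A$, then $\Xi';\sigma(\Gamma)\vdash\sigma(v):\sigma(A)$; and if $\Xi;\Gamma\vdash c:C$, then $\Xi';\sigma(\Gamma)\vdash\sigma(c):\sigma(C)$.
   Context: SYNTAX. Fix a global signature $\Sigma$: a finite set of operations $op$, each with two value types $A_{op},B_{op}$ (written $op:A_{op}\to B_{op}$) that contain no parameters, with $B_{op}$ not a function type. There are parameters of five kinds: skeleton $\varsigma$, dirt $\delta$, type $\alpha$, dirt coercion $\varpi$, type coercion $\omega$. Skeletons: $S::=\varsigma\mid\mathtt{Unit}\mid S_1\to S_2$. Dirts: $\Delta::=\delta\mid\emptyset\mid\{op\}\cup\Delta$, considered up to reordering and repetition of operations, so each dirt is $O$ or $O\cup\delta$ with $O$ a finite set of operations. Value types: $A::=\alpha\mid\mathtt{Unit}\mid A\to C$; computation types: $C::=A\,!\,\Delta$. A (parameter) context $\Xi$ is a finite list of distinct parameters: $\varsigma$; $\delta$; $\alpha:S$; $\varpi:\Delta_1\le\Delta_2$; $\omega:A_1\le A_2$. $\Xi\vdash S\ \mathtt{skel}$ (resp. $\Xi\vdash\Delta\ \mathtt{dirt}$) means all parameters of $S$ (resp. $\Delta$) are in $\Xi$ and all operations in $\Delta$ are in $\Sigma$. $\Xi\vdash A:S$ and $\Xi\vdash C:S$ (with $\Xi\vdash S\ \mathtt{skel}$) are given by: $\alpha:S$ if $(\alpha:S)\in\Xi$; $\mathtt{Unit}:\mathtt{Unit}$;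 $A\to C:S_1\to S_2$ if $A:S_1$, $C:S_2$; $A\,!\,\Delta:S$ if $A:S$ and $\Xi\vdash\Delta\ \mathtt{dirt}$. $\Xi$ is well-formed if all skeletons and dirts occurring in it are well-formed in $\Xi$ and for each $\omega:A_1\le A_2$ in $\Xi$ both $A_i$ have a common skeleton in $\Xi$. All contexts are assumed well-formed. COERCIONS. Dirt coercions $\gamma_d::=\varpi\mid\gamma_d^2\circ\gamma_d^1\mid\langle\delta\rangle\mid\langle\emptyset\rangle\mid\emptyset_\delta\mid\{op\}\cup\gamma_d\mid\{op\}\cup^+\gamma_d$; value coercions $\gamma_v::=\omega\mid\gamma_v^2\circ\gamma_v^1\mid\langle\alpha\rangle\mid\langle\mathtt{Unit}\rangle\mid\gamma_v\to\gamma_c$; computation coercions $\gamma_c::=\gamma_v\,!\,\gamma_d$. Rules in context $\Xi$ (both sides are presupposed well-formed, and for types of the same skeleton): $\varpi,\omega$ have the inequality declared in $\Xi$; $\gamma^2\circ\gamma^1:X\le Z$ if $\gamma^1:X\le Y$, $\gamma^2:Y\le Z$; $\langle\delta\rangle:\delta\le\delta$; $\langle\emptyset\rangle:\emptyset\le\emptyset$; $\emptyset_\delta:\emptyset\le\delta$; if $\gamma_d:\Delta\le\Delta'$ then $\{op\}\cup\gamma_d:\{op\}\cup\Delta\le\{op\}\cup\Delta'$ and $\{op\}\cup^+\gamma_d:\Delta\le\{op\}\cup\Delta'$; $\langle\alpha\rangle:\alpha\le\alpha$; $\langle\mathtt{Unit}\rangle:\mathtt{Unit}\le\mathtt{Unit}$;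 $\gamma_v\to\gamma_c:(A\to C)\le(A'\to C')$ if $\gamma_v:A'\le A$, $\gamma_c:C\le C'$; $\gamma_v\,!\,\gamma_d:(A\,!\,\Delta)\le(A'\,!\,\Delta')$ if $\gamma_v:A\le A'$, $\gamma_d:\Delta\le\Delta'$. For arbitrary dirts and types define $\emptyset_\emptyset=\langle\emptyset\rangle$, $\emptyset_{\{op\}\cup\Delta}=\{op\}\cup^+\emptyset_\Delta$, $\langle\{op\}\cup\Delta\rangle=\{op\}\cup\langle\Delta\rangle$, $\langle A\to C\rangle=\langle A\rangle\to\langle C\rangle$, $\langle A\,!\,\Delta\rangle=\langle A\rangle\,!\,\langle\Delta\rangle$. TERMS. Typing contexts $\Gamma=x_1:A_1,\dots,x_n:A_n$ (well-formed in $\Xi$ if each $A_i$ is). Values $v::=x\mid\mathtt{unit}\mid\mathtt{fun}\,(x:A)\mapsto c\mid v\vartriangleright\gamma_v$; computations $c::=\mathtt{return}\,v\mid op\,v\,(y:A.\,c)\mid\mathtt{do}\,x\leftarrow c_1;c_2\mid v_1\,v_2\mid c\vartriangleright\gamma_c$. Typing $\Xi;\Gamma\vdash v:A$, $\Xi;\Gamma\vdash c:C$: variables have their type in $\Gamma$; $\mathtt{unit}:\mathtt{Unit}$; $\mathtt{fun}\,(x:A)\mapsto c:A\to C$ if $c:C$ in $\Gamma,x:A$; $v\vartriangleright\gamma_v:A'$ if $v:A$, $\gamma_v:A\le A'$; $\mathtt{return}\,v:A\,!\,\emptyset$ if $v:A$; $\mathtt{do}\,x\leftarrow c_1;c_2:A'\,!\,\Delta$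 if $c_1:A\,!\,\Delta$ and $c_2:A'\,!\,\Delta$ in $\Gamma,x:A$; $v_1\,v_2:C$ if $v_1:A\to C$, $v_2:A$; $op\,v\,(y:B_{op}.\,c):A\,!\,\Delta$ if $op\in\Sigma$, $v:A_{op}$, $c:A\,!\,\Delta$ in $\Gamma,y:B_{op}$, and $op\in\Delta$; $c\vartriangleright\gamma_c:C'$ if $c:C$, $\gamma_c:C\le C'$. SUBSTITUTIONS. A valid substitution $\vdash\sigma:\Xi\Rightarrow\Xi'$ assigns to every parameter of $\Xi$: to $\varsigma$ a skeleton with $\Xi'\vdash\sigma(\varsigma)\ \mathtt{skel}$; to $\delta$ a dirt with $\Xi'\vdash\sigma(\delta)\ \mathtt{dirt}$; to $\alpha:S$ a value type with $\Xi'\vdash\sigma(\alpha):\sigma(S)$; to $\varpi:\Delta_1\le\Delta_2$ a coercion $\Xi'\vdash\sigma(\varpi):\sigma(\Delta_1)\le\sigma(\Delta_2)$; to $\omega:A_1\le A_2$ a coercion $\Xi'\vdash\sigma(\omega):\sigma(A_1)\le\sigma(A_2)$. It acts homomorphically on skeletons, dirts, types, coercions (with $\sigma(\langle\delta\rangle)=\langle\sigma(\delta)\rangle$, $\sigma(\langle\alpha\rangle)=\langle\sigma(\alpha)\rangle$, $\sigma(\emptyset_\delta)=\emptyset_{\sigma(\delta)}$), typing contexts and terms. *)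

(* Defs.v *)
From mathcomp Require Import all_boot finmap.
From Stdlib Require List.

Set Implicit Arguments.
Unset Strict Implicit.
Unset Printing Implicit Defensive.

Local Open Scope fset_scope.

(* Parameters are named by natural numbers, with a separate name space for each
   of the five kinds. Term variables are also named by natural numbers. *)

Inductive skel : Type :=
| SVar (s : nat)
| SUnit
| SArr (S1 S2 : skel).

Section Syntax.
Variable Op : choiceType.

(* Dirts are taken up to reordering and repetition: a dirt is a finite set [O]
   of operations, followed either by nothing or by one dirt parameter. *)
Record dirt : Type := Dirt { dops : {fset Op}; dtail : option nat }.

Definition dirt_empty : dirt := Dirt fset0 None.
Definition dirt_var (d : nat) : dirt := Dirt fset0 (Some d).
Definition dirt_cons (op : Op) (D : dirt) : dirt :=
  Dirt (op |` dops D) (dtail D).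

Inductive vty : Type :=
| TVar (a : nat)
| TUnit
| TArr (A : vty) (C : cty)
with cty : Type :=
| CTy (A : vty) (D : dirt).

Fixpoint vty_closed (A : vty) : bool :=
  match A with
  | TVar _ => false
  | TUnit => true
  | TArr A C => vty_closed A && cty_closed C
  end
with cty_closed (C : cty) : bool :=
  match C with
  | CTy A D => vty_closed A && ~~ isSome (dtail D)
  end.

Definition is_arrow (A : vty) : bool :=
  if A is TArr _ _ then true else false.

(* [sig_arg op] and [sig_res op] are A_op and B_op; their values are irrelevant
   for [op] outside of [sig_ops]. *)
Record signature : Type := Signature {
  sig_ops : {fset Op};
  sig_arg : Op -> vty;
  sig_res : Op -> vty;
  sig_arg_closed : forall op, op \in sig_ops -> vty_closed (sig_arg op);
  sig_res_closed : forall op, op \in sig_ops -> vty_closed (sig_res op);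
  sig_res_not_arrow : forall op, op \in sig_ops -> ~~ is_arrow (sig_res op)
}.

Inductive decl : Type :=
| DeclSkel (s : nat)
| DeclDirt (d : nat)
| DeclTy (a : nat) (S : skel)
| DeclDco (w : nat) (D1 D2 : dirt)
| DeclVco (w : nat) (A1 A2 : vty).

Definition ctx : Type := list decl.

(* [DCCons op g] is {op} U g and [DCConsR op g] is {op} U^+ g. *)
Inductive dco : Type :=
| DCVar (w : nat)
| DCComp (g2 g1 : dco)
| DCReflVar (d : nat)
| DCReflEmpty
| DCEmptyVar (d : nat)
| DCCons (op : Op) (g : dco)
| DCConsR (op : Op) (g : dco).

Inductive vco : Type :=
| VCVar (w : nat)
| VCComp (g2 g1 : vco)
| VCReflVar (a : nat)
| VCReflUnit
| VCArr (gv : vco) (gc : cco)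
with cco : Type :=
| CCo (gv : vco) (gd : dco).

Inductive value : Type :=
| Var (x : nat)
| Unit
| Fun (x : nat) (A : vty) (c : computation)
| VCast (v : value) (g : vco)
with computation : Type :=
| Return (v : value)
| OpCall (op : Op) (v : value) (y : nat) (B : vty) (c : computation)
| Do (x : nat) (c1 c2 : computation)
| App (v1 v2 : value)
| CCast (c : computation) (g : cco).

(* The most recent binding comes first. *)
Definition tctx : Type := list (nat * vty).

End Syntax.

Arguments dirt_empty {Op}.
Arguments dirt_var {Op} d.
Arguments TVar {Op} a.
Arguments TUnit {Op}.
Arguments DeclSkel {Op} s.
Arguments DeclDirt {Op} d.
Arguments DeclTy {Op} a S.
Arguments DCVar {Op} w.
Arguments DCReflVar {Op} d.
Arguments DCReflEmpty {Op}.
Arguments DCEmptyVar {Op} d.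
Arguments VCVar {Op} w.
Arguments VCReflVar {Op} a.
Arguments VCReflUnit {Op}.
Arguments Var {Op} x.
Arguments Unit {Op}.

Section Contexts.
Variables (Op : choiceType) (Sg : signature Op).

Inductive param : Type :=
| PSkel (s : nat)
| PDirt (d : nat)
| PTy (a : nat)
| PDco (w : nat)
| PVco (w : nat).

Definition decl_param (e : decl Op) : param :=
  match e with
  | DeclSkel s => PSkel s
  | DeclDirt d => PDirt d
  | DeclTy a _ => PTy a
  | DeclDco w _ _ => PDco w
  | DeclVco w _ _ => PVco w
  end.

Fixpoint wf_skel (Xi : ctx Op) (S : skel) : Prop :=
  match S with
  | SVar s => List.In (DeclSkel s) Xi
  | SUnit => True
  | SArr S1 S2 => wf_skel Xi S1 /\ wf_skel Xi S2
  end.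

Definition wf_dirt (Xi : ctx Op) (D : dirt Op) : Prop :=
  dops D `<=` sig_ops Sg /\
  (forall d, dtail D = Some d -> List.In (DeclDirt d) Xi).

Inductive vty_skel (Xi : ctx Op) : vty Op -> skel -> Prop :=
| KVar a S : List.In (DeclTy a S) Xi -> wf_skel Xi S -> vty_skel Xi (TVar a) S
| KUnit : vty_skel Xi TUnit SUnit
| KArr A C S1 S2 : vty_skel Xi A S1 -> cty_skel Xi C S2 ->
    vty_skel Xi (TArr A C) (SArr S1 S2)
with cty_skel (Xi : ctx Op) : cty Op -> skel -> Prop :=
| KCTy A D S : vty_skel Xi A S -> wf_dirt Xi D -> cty_skel Xi (CTy A D) S.

Definition vty_same_skel (Xi : ctx Op) (A A' : vty Op) : Prop :=
  exists S, vty_skel Xi A S /\ vty_skel Xi A' S.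

Definition cty_same_skel (Xi : ctx Op) (C C' : cty Op) : Prop :=
  exists S, cty_skel Xi C S /\ cty_skel Xi C' S.

(* Declarations may refer to any parameter of the context, in any position. *)
Definition wf_decl (Xi : ctx Op) (e : decl Op) : Prop :=
  match e with
  | DeclSkel _ => True
  | DeclDirt _ => True
  | DeclTy _ K => wf_skel Xi K
  | DeclDco _ D1 D2 => wf_dirt Xi D1 /\ wf_dirt Xi D2
  | DeclVco _ A1 A2 => vty_same_skel Xi A1 A2
  end.

Definition wf_ctx (Xi : ctx Op) : Prop :=
  List.NoDup (List.map decl_param Xi) /\
  (forall e, List.In e Xi -> wf_decl Xi e).

(* Every rule for coercions carries the presupposition that both sides are
   well-formed and, for types, have a common skeleton. *)

Inductive dco_ty (Xi : ctx Op) : dco Op -> dirt Op -> dirt Op -> Prop :=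
| DT_var w D1 D2 :
    wf_dirt Xi D1 -> wf_dirt Xi D2 ->
    List.In (DeclDco w D1 D2) Xi -> dco_ty Xi (DCVar w) D1 D2
| DT_comp g1 g2 D1 D2 D3 :
    wf_dirt Xi D1 -> wf_dirt Xi D3 ->
    dco_ty Xi g1 D1 D2 -> dco_ty Xi g2 D2 D3 -> dco_ty Xi (DCComp g2 g1) D1 D3
| DT_refl_var d :
    wf_dirt Xi (dirt_var d) ->
    dco_ty Xi (DCReflVar d) (dirt_var d) (dirt_var d)
| DT_refl_empty : dco_ty Xi DCReflEmpty dirt_empty dirt_empty
| DT_empty_var d :
    wf_dirt Xi (dirt_var d) ->
    dco_ty Xi (DCEmptyVar d) dirt_empty (dirt_var d)
| DT_cons op g D D' :
    wf_dirt Xi (dirt_cons op D) -> wf_dirt Xi (dirt_cons op D') ->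
    dco_ty Xi g D D' ->
    dco_ty Xi (DCCons op g) (dirt_cons op D) (dirt_cons op D')
| DT_consR op g D D' :
    wf_dirt Xi D -> wf_dirt Xi (dirt_cons op D') ->
    dco_ty Xi g D D' -> dco_ty Xi (DCConsR op g) D (dirt_cons op D').

Inductive vco_ty (Xi : ctx Op) : vco Op -> vty Op -> vty Op -> Prop :=
| VT_var w A1 A2 :
    vty_same_skel Xi A1 A2 ->
    List.In (DeclVco w A1 A2) Xi -> vco_ty Xi (VCVar w) A1 A2
| VT_comp g1 g2 A1 A2 A3 :
    vty_same_skel Xi A1 A3 ->
    vco_ty Xi g1 A1 A2 -> vco_ty Xi g2 A2 A3 -> vco_ty Xi (VCComp g2 g1) A1 A3
| VT_refl_var a :
    vty_same_skel Xi (TVar a) (TVar a) ->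
    vco_ty Xi (VCReflVar a) (TVar a) (TVar a)
| VT_refl_unit : vco_ty Xi VCReflUnit TUnit TUnit
| VT_arr gv gc A A' C C' :
    vty_same_skel Xi (TArr A C) (TArr A' C') ->
    vco_ty Xi gv A' A -> cco_ty Xi gc C C' ->
    vco_ty Xi (VCArr gv gc) (TArr A C) (TArr A' C')
with cco_ty (Xi : ctx Op) : cco Op -> cty Op -> cty Op -> Prop :=
| CT_cco gv gd A A' D D' :
    cty_same_skel Xi (CTy A D) (CTy A' D') ->
    vco_ty Xi gv A A' -> dco_ty Xi gd D D' ->
    cco_ty Xi (CCo gv gd) (CTy A D) (CTy A' D').

(* A variable bound several times has the type of its most recent binding. *)
Fixpoint lookup (G : tctx Op) (x : nat) : option (vty Op) :=
  match G with
  | nil => None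
  | (y, A) :: G' => if x == y then Some A else lookup G' x
  end.

Definition wf_tctx (Xi : ctx Op) (G : tctx Op) : Prop :=
  forall x A, List.In (x, A) G -> exists S, vty_skel Xi A S.

(* Typing contexts are presupposed to be well-formed: this is required at the
   leaves of derivations, hence holds throughout them. *)
Inductive val_ty (Xi : ctx Op) : tctx Op -> value Op -> vty Op -> Prop :=
| Ty_var G x A : wf_tctx Xi G -> lookup G x = Some A -> val_ty Xi G (Var x) A
| Ty_unit G : wf_tctx Xi G -> val_ty Xi G Unit TUnit
| Ty_fun G x A c C :
    comp_ty Xi ((x, A) :: G) c C -> val_ty Xi G (Fun x A c) (TArr A C)
| Ty_vcast G v g A A' :
    val_ty Xi G v A -> vco_ty Xi g A A' -> val_ty Xi G (VCast v g) A'
with comp_ty (Xi : ctx Op) : tctx Op -> computation Op -> cty Op -> Prop :=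
| Ty_return G v A :
    val_ty Xi G v A -> comp_ty Xi G (Return v) (CTy A dirt_empty)
| Ty_op G op v y c A D :
    op \in sig_ops Sg ->
    val_ty Xi G v (sig_arg Sg op) ->
    comp_ty Xi ((y, sig_res Sg op) :: G) c (CTy A D) ->
    op \in dops D ->
    comp_ty Xi G (OpCall op v y (sig_res Sg op) c) (CTy A D)
| Ty_do G x c1 c2 A A' D :
    comp_ty Xi G c1 (CTy A D) ->
    comp_ty Xi ((x, A) :: G) c2 (CTy A' D) ->
    comp_ty Xi G (Do x c1 c2) (CTy A' D)
| Ty_app G v1 v2 A C :
    val_ty Xi G v1 (TArr A C) -> val_ty Xi G v2 A ->
    comp_ty Xi G (App v1 v2) C
| Ty_ccast G c g C C' :
    comp_ty Xi G c C -> cco_ty Xi g C C' -> comp_ty Xi G (CCast c g) C'.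

End Contexts.

Section Substitution.
Variable Op : choiceType.

(* The recursive definitions of the coercions <D> and 0_D follow the
   enumeration of the finite set [dops D]. *)

Definition dco_refl (D : dirt Op) : dco Op :=
  foldr (@DCCons Op)
    (if dtail D is Some d then DCReflVar d else DCReflEmpty)
    (enum_fset (dops D)).

Definition dco_empty (D : dirt Op) : dco Op :=
  foldr (@DCConsR Op)
    (if dtail D is Some d then DCEmptyVar d else DCReflEmpty)
    (enum_fset (dops D)).

Fixpoint vco_refl (A : vty Op) : vco Op :=
  match A with
  | TVar a => VCReflVar a
  | TUnit => VCReflUnit
  | TArr A C => VCArr (vco_refl A) (cco_refl C)
  end
with cco_refl (C : cty Op) : cco Op :=
  match C with
  | CTy A D => CCo (vco_refl A) (dco_refl D)
  end.

(* The components are total functions, but only their values at the parameters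
   of the source context are constrained by [valid_subst] below. *)
Record subst : Type := Subst {
  s_skel : nat -> skel;
  s_dirt : nat -> dirt Op;
  s_vty : nat -> vty Op;
  s_dco : nat -> dco Op;
  s_vco : nat -> vco Op
}.

Variable sigma : subst.

Fixpoint subst_skel (S : skel) : skel :=
  match S with
  | SVar s => s_skel sigma s
  | SUnit => SUnit
  | SArr S1 S2 => SArr (subst_skel S1) (subst_skel S2)
  end.

Definition subst_dirt (D : dirt Op) : dirt Op :=
  if dtail D is Some d
  then Dirt (dops D `|` dops (s_dirt sigma d)) (dtail (s_dirt sigma d))
  else D.

Fixpoint subst_vty (A : vty Op) : vty Op :=
  match A with
  | TVar a => s_vty sigma a
  | TUnit => TUnit
  | TArr A C => TArr (subst_vty A) (subst_cty C)
  end
with subst_cty (C : cty Op) : cty Op :=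
  match C with
  | CTy A D => CTy (subst_vty A) (subst_dirt D)
  end.

Fixpoint subst_dco (g : dco Op) : dco Op :=
  match g with
  | DCVar w => s_dco sigma w
  | DCComp g2 g1 => DCComp (subst_dco g2) (subst_dco g1)
  | DCReflVar d => dco_refl (s_dirt sigma d)
  | DCReflEmpty => DCReflEmpty
  | DCEmptyVar d => dco_empty (s_dirt sigma d)
  | DCCons op g => DCCons op (subst_dco g)
  | DCConsR op g => DCConsR op (subst_dco g)
  end.

Fixpoint subst_vco (g : vco Op) : vco Op :=
  match g with
  | VCVar w => s_vco sigma w
  | VCComp g2 g1 => VCComp (subst_vco g2) (subst_vco g1)
  | VCReflVar a => vco_refl (s_vty sigma a)
  | VCReflUnit => VCReflUnit
  | VCArr gv gc => VCArr (subst_vco gv) (subst_cco gc)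
  end
with subst_cco (g : cco Op) : cco Op :=
  match g with
  | CCo gv gd => CCo (subst_vco gv) (subst_dco gd)
  end.

Fixpoint subst_val (v : value Op) : value Op :=
  match v with
  | Var x => Var x
  | Unit => Unit
  | Fun x A c => Fun x (subst_vty A) (subst_comp c)
  | VCast v g => VCast (subst_val v) (subst_vco g)
  end
with subst_comp (c : computation Op) : computation Op :=
  match c with
  | Return v => Return (subst_val v)
  | OpCall op v y B c =>
      OpCall op (subst_val v) y (subst_vty B) (subst_comp c)
  | Do x c1 c2 => Do x (subst_comp c1) (subst_comp c2)
  | App v1 v2 => App (subst_val v1) (subst_val v2)
  | CCast c g => CCast (subst_comp c) (subst_cco g)
  end.

Definition subst_tctx (G : tctx Op) : tctx Op :=
  List.map (fun b => (b.1, subst_vty b.2)) G.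

Definition valid_subst (Sg : signature Op) (Xi Xi' : ctx Op) : Prop :=
  forall e, List.In e Xi ->
    match e with
    | DeclSkel s => wf_skel Xi' (s_skel sigma s)
    | DeclDirt d => wf_dirt Sg Xi' (s_dirt sigma d)
    | DeclTy a K => vty_skel Sg Xi' (s_vty sigma a) (subst_skel K)
    | DeclDco w D1 D2 =>
        dco_ty Sg Xi' (s_dco sigma w) (subst_dirt D1) (subst_dirt D2)
    | DeclVco w A1 A2 =>
        vco_ty Sg Xi' (s_vco sigma w) (subst_vty A1) (subst_vty A2)
    end.

End Substitution.

(* Main.v *)
(* Each judgement (skeletons, coercions, terms) is stable under substitution by
   induction on its derivation. The only rules that are not mapped to themselves
   are those for parameters: [<delta>], [<alpha>] and [0_delta] become the
   derived coercions [<Delta>], [<A>] and [0_Delta], which are shown to be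
   well-typed, while declared coercions are handled by validity of the
   substitution. Types in the signature contain no parameters, so they are left
   unchanged. *)

Require Import Defs.
From mathcomp Require Import all_boot finmap.

Local Open Scope fset_scope.

Scheme vty_mind := Induction for vty Sort Prop
  with cty_mind := Induction for cty Sort Prop.
Combined Scheme vty_cty_ind from vty_mind, cty_mind.

Scheme vty_skel_mind := Minimality for vty_skel Sort Prop
  with cty_skel_mind := Minimality for cty_skel Sort Prop.
Combined Scheme vty_cty_skel_ind from vty_skel_mind, cty_skel_mind.

Scheme vco_ty_mind := Minimality for vco_ty Sort Prop
  with cco_ty_mind := Minimality for cco_ty Sort Prop.
Combined Scheme vco_cco_ty_ind from vco_ty_mind, cco_ty_mind.

Scheme val_ty_mind := Minimality for val_ty Sort Prop
  with comp_ty_mind := Minimality for comp_ty Sort Prop.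
Combined Scheme val_comp_ty_ind from val_ty_mind, comp_ty_mind.

Section Reflexivity.
Variables (Op : choiceType) (Sg : signature Op) (Xi : ctx Op).

Lemma wf_dirt_empty : wf_dirt Sg Xi dirt_empty.
Proof. by split; [exact: fsub0set |]. Qed.

Lemma wf_dirt_cons op (D : dirt Op) :
  wf_dirt Sg Xi (dirt_cons op D) <-> op \in sig_ops Sg /\ wf_dirt Sg Xi D.
Proof.
rewrite /wf_dirt /= fsubUset fsub1set.
by split=> [[/andP[]]|[-> [->]]].
Qed.

Lemma foldr_dirt_cons (s : seq Op) t :
  foldr (@dirt_cons Op) (Dirt fset0 t) s = Dirt [fset op in s] t.
Proof.
elim: s => [|op s /= ->]; congr Dirt; apply/fsetP => o; first by rewrite !inE.
by rewrite !inE.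
Qed.

(** Presents a dirt along the very enumeration that [dco_refl] and [dco_empty] fold over, so that
    both can be typed by induction on that list. *)
Lemma dirt_enum (D : dirt Op) :
  foldr (@dirt_cons Op) (Dirt fset0 (dtail D)) (enum_fset (dops D)) = D.
Proof.
case: D => O t; rewrite foldr_dirt_cons; congr Dirt.
by apply/fsetP => o; rewrite !inE.
Qed.

Lemma dco_refl_ty (D : dirt Op) :
  wf_dirt Sg Xi D -> dco_ty Sg Xi (dco_refl D) D D.
Proof.
(* The premise and both sides are rewritten, but not the [D] inside the coercion, which already
   folds over the enumeration; one list then governs the whole goal. *)
rewrite -{1 3 4}(dirt_enum D) /dco_refl.
elim: (enum_fset _) => [|op s IH] /= wfD.
  by case: (dtail D) wfD => [d|] wfD; constructor.
by constructor=> //; apply: IH; case/wf_dirt_cons: wfD.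
Qed.

Lemma dco_empty_ty (D : dirt Op) :
  wf_dirt Sg Xi D -> dco_ty Sg Xi (dco_empty D) dirt_empty D.
Proof.
rewrite -{1 3}(dirt_enum D) /dco_empty.
elim: (enum_fset _) => [|op s IH] /= wfD.
  by case: (dtail D) wfD => [d|] wfD; constructor.
(* The left side stays empty throughout, so each operation enters on the right only. *)
apply: DT_consR; [exact: wf_dirt_empty | exact: wfD |].
by apply: IH; case/wf_dirt_cons: wfD.
Qed.

(** Induction on the skeleton derivation, not on the type, keeps at hand the common skeleton that
    every coercion rule presupposes. *)
Lemma vco_cco_refl_ty :
  (forall A S, vty_skel Sg Xi A S -> vco_ty Sg Xi (vco_refl A) A A) /\
  (forall C S, cty_skel Sg Xi C S -> cco_ty Sg Xi (cco_refl C) C C).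
Proof.
apply: vty_cty_skel_ind => [a S aS wfS||A C S1 S2 AS IHA CS IHC|A D S AS IHA wfD] /=.
- by constructor; exists S; split; constructor.
- by constructor.
- by constructor=> //; exists (SArr S1 S2); split; constructor.
- constructor=> //; last exact: dco_refl_ty.
  by exists S; split; constructor.
Qed.

End Reflexivity.

Section Substitution.
Variables (Op : choiceType) (sigma : subst Op).

(** Matches the sides of the images of [DCReflVar d] and [DCEmptyVar d] with those of the derived
    coercions for [s_dirt sigma d]. *)
Lemma subst_dirt_var d : subst_dirt sigma (dirt_var d) = s_dirt sigma d.
Proof. by rewrite /subst_dirt /= fset0U; case: (s_dirt _ _). Qed.

(** Only the tail is replaced, so an added operation can be pulled out by associativity of union. *)
Lemma subst_dirt_cons op D :
  subst_dirt sigma (dirt_cons op D) = dirt_cons op (subst_dirt sigma D).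
Proof.
by case: D => O [d|] //; rewrite /subst_dirt /dirt_cons /= fsetUA.
Qed.

(** Substitution adds at most the operations of the dirt replacing the tail; this preserves the
    membership condition of [Ty_op]. *)
Lemma dops_subst_dirt D : dops D `<=` dops (subst_dirt sigma D).
Proof. by case: D => O [d|]; rewrite /subst_dirt /= ?fsubsetUl. Qed.

(** Closedness excludes type parameters and dirt tails, the only places where substitution acts on a
    type. *)
Lemma subst_closed :
  (forall A : vty Op, vty_closed A -> subst_vty sigma A = A) /\
  (forall C : cty Op, cty_closed C -> subst_cty sigma C = C).
Proof.
apply: vty_cty_ind => //= [A IHA C IHC /andP[/IHA-> /IHC->] //|].
by move=> A IHA [O [d|]] /andP[/IHA->].
Qed.

Lemma lookup_subst_tctx G x A :
  lookup G x = Some A ->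
  lookup (subst_tctx sigma G) x = Some (subst_vty sigma A).
Proof. by elim: G => [|[y B] G IH] //=; case: eqP => // _ [->]. Qed.

Variables (Sg : signature Op) (Xi Xi' : ctx Op).
Hypothesis validsigma : valid_subst sigma Sg Xi Xi'.

Lemma wf_skel_subst S : wf_skel Xi S -> wf_skel Xi' (subst_skel sigma S).
Proof.
elim: S => [s /validsigma||S1 IH1 S2 IH2] //= [/IH1 ? /IH2 ?].
by split.
Qed.

Lemma wf_dirt_subst D : wf_dirt Sg Xi D -> wf_dirt Sg Xi' (subst_dirt sigma D).
Proof.
case: D => O [d|] [/= subO wft]; last by split.
have [subd wfd] := validsigma _ (wft d erefl).
by split; rewrite /subst_dirt //= fsubUset subO.
Qed.

Lemma skel_subst :
  (forall A S, vty_skel Sg Xi A S ->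
     vty_skel Sg Xi' (subst_vty sigma A) (subst_skel sigma S)) /\
  (forall C S, cty_skel Sg Xi C S ->
     cty_skel Sg Xi' (subst_cty sigma C) (subst_skel sigma S)).
Proof.
apply: vty_cty_skel_ind => /= [a S /validsigma //|||]; try by constructor.
by move=> A D S _ IHA /wf_dirt_subst wfD; constructor.
Qed.

Lemma vty_same_skel_subst A A' :
  vty_same_skel Sg Xi A A' ->
  vty_same_skel Sg Xi' (subst_vty sigma A) (subst_vty sigma A').
Proof.
by case=> S [AS AS']; exists (subst_skel sigma S); split; apply: skel_subst.1.
Qed.

Lemma cty_same_skel_subst C C' :
  cty_same_skel Sg Xi C C' ->
  cty_same_skel Sg Xi' (subst_cty sigma C) (subst_cty sigma C').
Proof.
by case=> S [CS CS']; exists (subst_skel sigma S); split; apply: skel_subst.2.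
Qed.

Lemma dco_ty_subst g D D' :
  dco_ty Sg Xi g D D' ->
  dco_ty Sg Xi' (subst_dco sigma g) (subst_dirt sigma D) (subst_dirt sigma D').
Proof.
elim=> {g D D'} /=.
- by move=> w D1 D2 _ _ /validsigma.
- move=> g1 g2 D1 D2 D3 /wf_dirt_subst wf1 /wf_dirt_subst wf3 _ IH1 _ IH2.
  exact: DT_comp IH1 IH2.
- move=> d /wf_dirt_subst; rewrite subst_dirt_var; exact: dco_refl_ty.
- by constructor.
- move=> d /wf_dirt_subst; rewrite subst_dirt_var; exact: dco_empty_ty.
- move=> op g D D' /wf_dirt_subst wfD /wf_dirt_subst wfD' _ IH.
  by move: wfD wfD'; rewrite !subst_dirt_cons; constructor.
- move=> op g D D' /wf_dirt_subst wfD /wf_dirt_subst wfD' _ IH.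
  by move: wfD'; rewrite !subst_dirt_cons; constructor.
Qed.

Lemma vco_cco_ty_subst :
  (forall g A A', vco_ty Sg Xi g A A' ->
     vco_ty Sg Xi' (subst_vco sigma g) (subst_vty sigma A) (subst_vty sigma A'))
  /\
  (forall g C C', cco_ty Sg Xi g C C' ->
     cco_ty Sg Xi' (subst_cco sigma g) (subst_cty sigma C) (subst_cty sigma C')).
Proof.
apply: vco_cco_ty_ind => /=.
- by move=> w A1 A2 _ /validsigma.
- move=> g1 g2 A1 A2 A3 /vty_same_skel_subst sk _ IH1 _ IH2.
  exact: VT_comp IH1 IH2.
- move=> a /vty_same_skel_subst [S [aS _]].
  (* [aS], from the substituted presupposition, gives the image of the parameter a skeleton, as
     derived reflexivity requires. *)
  exact: (vco_cco_refl_ty _ _ _).1 aS.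
- by constructor.
- by move=> gv gc A A' C C' /vty_same_skel_subst sk _ IHv _ IHc; constructor.
- move=> gv gd A A' D D' /cty_same_skel_subst sk _ IHv /dco_ty_subst IHd.
  by constructor.
Qed.

Lemma wf_tctx_subst G :
  wf_tctx Sg Xi G -> wf_tctx Sg Xi' (subst_tctx sigma G).
Proof.
move=> wfG x A /List.in_map_iff [[y B] [[_ <-] /wfG [S BS]]].
exists (subst_skel sigma S); exact: skel_subst.1.
Qed.

End Substitution.

Theorem theorem3p4 (Op : choiceType) (Sg : signature Op) (Xi Xi' : ctx Op)
    (sigma : subst Op)
    (wfXi : wf_ctx Sg Xi) (wfXi' : wf_ctx Sg Xi')
    (validsigma : valid_subst sigma Sg Xi Xi') :
  (forall (G : tctx Op) (v : value Op) (A : vty Op),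
     val_ty Sg Xi G v A ->
     val_ty Sg Xi' (subst_tctx sigma G) (subst_val sigma v) (subst_vty sigma A))
  /\
  (forall (G : tctx Op) (c : computation Op) (C : cty Op),
     comp_ty Sg Xi G c C ->
     comp_ty Sg Xi' (subst_tctx sigma G) (subst_comp sigma c) (subst_cty sigma C)).
Proof.
have sub_arg op : op \in sig_ops Sg ->
    subst_vty sigma (sig_arg Sg op) = sig_arg Sg op.
  by move=> opSg; apply: (subst_closed _ _).1; apply: sig_arg_closed.
have sub_res op : op \in sig_ops Sg ->
    subst_vty sigma (sig_res Sg op) = sig_res Sg op.
  by move=> opSg; apply: (subst_closed _ _).1; apply: sig_res_closed.
apply: val_comp_ty_ind => /=.
- move=> G x A wfG /(lookup_subst_tctx _ sigma) xA.
  by constructor=> //; apply: wf_tctx_subst wfG.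
- by move=> G wfG; constructor; apply: wf_tctx_subst wfG.
- by move=> G x A c C _ IH; constructor.
- move=> G v g A A' _ IH gA; apply: Ty_vcast IH _.
  exact: (vco_cco_ty_subst _ _ _ _ _ validsigma).1.
- by move=> G v A _ IH; apply: Ty_return.
- move=> G op v y c A D opSg _ IHv _ IHc opD.
  (* [Ty_op] demands the signature types literally, in the argument, the bound variable and the
     annotation, so their substituted forms are first reduced to them. *)
  rewrite sub_arg ?sub_res // in IHv IHc *.
  constructor=> //; exact: fsubsetP (dops_subst_dirt _ _ _) _ opD.
- by move=> G x c1 c2 A A' D _ IH1 _ IH2; apply: Ty_do IH1 IH2.
- by move=> G v1 v2 A C _ IH1 _ IH2; apply: Ty_app IH1 IH2.
- move=> G c g C C' _ IH gC; apply: Ty_ccast IH _.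
  exact: (vco_cco_ty_subst _ _ _ _ _ validsigma).2.
Qed.
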